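(* Let $L,d_{\mathrm{model}},d_h,H_Q,H_{KV}$ be positive integers, let $\pi:\{1,\dots,H_Q\}\to\{1,\dots,H_{KV}\}$ be any map, and let $W_Q\in\mathbb{R}^{d_{\mathrm{model}}\times(H_Qd_h)}$, $W_K,W_V\in\mathbb{R}^{d_{\mathrm{model}}\times(H_{KV}d_h)}$, $W_O\in\mathbb{R}^{(H_Qd_h)\times d_{\mathrm{model}}}$. Let $S_1,\dots,S_{H_{KV}}\in O(d_h)$ be orthogonal matrices, and set $$S_{KV}=\operatorname{blkdiag}(S_1,\dots,S_{H_{KV}}),\qquad U=\operatorname{blkdiag}(S_{\pi(1)},\dots,S_{\pi(H_Q)}).$$ Define the reparameterized weights $$W_Q'=W_QU,\qquad W_K'=W_KS_{KV},\qquad W_V'=W_VS_{KV},\qquad W_O'=U^\top W_O .$$ Then for every input $X\in\mathbb{R}^{L\times d_{\mathrm{model}}}$ the grouped-query attention output $Y'$ computed with $(W_Q',W_K',W_V',W_O')$ equals the output $Y$ computed with $(W_Q,W_K,W_V,W_O)$.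
   Context: Grouped-query attention output: given weights $(W_Q,W_K,W_V,W_O)$, the head assignment $\pi$, and input $X\in\mathbb{R}^{L\times d_{\mathrm{model}}}$, put $Q=XW_Q$, $K=XW_K$, $V=XW_V$ and partition the columns into consecutive blocks of width $d_h$: $Q=[Q_1\mid\cdots\mid Q_{H_Q}]$, $K=[K_1\mid\cdots\mid K_{H_{KV}}]$, $V=[V_1\mid\cdots\mid V_{H_{KV}}]$, with $Q_i,K_j,V_j\in\mathbb{R}^{L\times d_h}$. For each $i$ let $A_i=\mathrm{softmax}\big(\tfrac{1}{\sqrt{d_h}}Q_iK_{\pi(i)}^\top\big)$ (softmax applied row-wise) and $O_i=A_iV_{\pi(i)}$. The output is $Y=[O_1\mid\cdots\mid O_{H_Q}]\,W_O$. $\operatorname{blkdiag}$ denotes the block-diagonal matrix with the given blocks. *)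

(* Defs.v *)
From mathcomp Require Import all_boot all_order all_algebra.
From mathcomp Require Import reals sequences exp.

Set Implicit Arguments.
Unset Strict Implicit.
Unset Printing Implicit Defensive.

Import GRing.Theory Num.Theory.
Local Open Scope ring_scope.

(* The block operations of matrix.v index the blocks by dimensions of the form
   \sum_(i < H) d; the casts below transport them to dimension H * d. By
   tagnat.RankEsum, entry k of block i sits at index i * d + k. *)
Lemma blk_dim (H d : nat) : (\sum_(i < H) d)%N = (H * d)%N.
Proof. by rewrite sum_nat_const card_ord. Qed.

Section Blocks.
Variables (R : realType) (H d : nat).

Definition colblock m (A : 'M[R]_(m, H * d)) (i : 'I_H) : 'M[R]_(m, d) :=
  submxrow (castmx (erefl m, esym (blk_dim H d)) A) i.

Definition hconcat m (B : 'I_H -> 'M[R]_(m, d)) : 'M[R]_(m, H * d) :=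
  castmx (erefl m, blk_dim H d) (\mxrow_(i < H) B i).

Definition blkdiag (B : 'I_H -> 'M[R]_d) : 'M[R]_(H * d) :=
  castmx (blk_dim H d, blk_dim H d) (\mxdiag_(i < H) B i).

End Blocks.

Definition orthogonal_mx (R : realType) n (S : 'M[R]_n) : Prop :=
  S^T *m S = 1%:M.

Definition softmax (R : realType) m n (A : 'M[R]_(m, n)) : 'M[R]_(m, n) :=
  \matrix_(i, j) (expR (A i j) / \sum_k expR (A i k)).

Section GroupedQueryAttention.
Variables (R : realType) (L dmodel dh HQ HKV : nat).
Variable pi : 'I_HQ -> 'I_HKV.
Variables (WQ : 'M[R]_(dmodel, HQ * dh)) (WK WV : 'M[R]_(dmodel, HKV * dh)).
Variables (WO : 'M[R]_(HQ * dh, dmodel)) (X : 'M[R]_(L, dmodel)).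

Definition gqa_weights (i : 'I_HQ) : 'M[R]_L :=
  softmax ((Num.sqrt dh%:R)^-1 *:
    (colblock (X *m WQ) i *m (colblock (X *m WK) (pi i))^T)).

Definition gqa_head (i : 'I_HQ) : 'M[R]_(L, dh) :=
  gqa_weights i *m colblock (X *m WV) (pi i).

Definition gqa : 'M[R]_(L, dmodel) := hconcat gqa_head *m WO.

End GroupedQueryAttention.

(* Main.v *)
(** Head [i] sees its query, key and value blocks all multiplied on the right by
    the same orthogonal [S (pi i)].  In the logits it cancels against its
    transpose, so the attention weights do not change; the head output picks up
    the factor [S (pi i)], which block [i] of [U^T] cancels. *)

Require Import Defs.
From mathcomp Require Import all_boot all_order all_algebra.
From mathcomp Require Import reals sequences exp.

Set Implicit Arguments.
Unset Strict Implicit.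
Unset Printing Implicit Defensive.

Import GRing.Theory Num.Theory.
Local Open Scope ring_scope.

(** Carries block products, stated for widths that are sums, over to width [H * d]. *)
Lemma mulmx_castmx (R : pzSemiRingType) m n n' p p' (eqn : n = n') (eqp : p = p')
    (A : 'M[R]_(m, n)) (B : 'M[R]_(n, p)) :
  castmx (erefl m, eqn) A *m castmx (eqn, eqp) B =
  castmx (erefl m, eqp) (A *m B).
Proof. by case: n' / eqn; case: p' / eqp. Qed.

Lemma hconcat_colblock (R : realType) H d m (A : 'M[R]_(m, H * d)) :
  hconcat (colblock A) = A.
Proof. by rewrite /hconcat /colblock submxrowK castmxKV. Qed.

Lemma colblock_hconcat (R : realType) H d m (B : 'I_H -> 'M[R]_(m, d)) i :
  colblock (hconcat B) i = B i.
Proof. by rewrite /hconcat /colblock castmx_comp castmx_id mxrowK. Qed.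

Lemma hconcat_mul_blkdiag (R : realType) H d m
    (B : 'I_H -> 'M[R]_(m, d)) (D : 'I_H -> 'M[R]_d) :
  hconcat B *m blkdiag D = hconcat (fun i => B i *m D i).
Proof. by rewrite /hconcat /blkdiag mulmx_castmx mul_mxrow_mxdiag. Qed.

(** Viewing [A] as the row of its own column blocks reduces this to a block row times a block
    diagonal. *)
Lemma colblock_mul_blkdiag (R : realType) H d m
    (A : 'M[R]_(m, H * d)) (D : 'I_H -> 'M[R]_d) i :
  colblock (A *m blkdiag D) i = colblock A i *m D i.
Proof.
by rewrite -{1}[A]hconcat_colblock hconcat_mul_blkdiag colblock_hconcat.
Qed.

Lemma tr_blkdiag (R : realType) H d (D : 'I_H -> 'M[R]_d) :
  (blkdiag D)^T = blkdiag (fun i => (D i)^T).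
Proof. by rewrite /blkdiag trmx_cast tr_mxdiag. Qed.

Theorem mainTheorem3 (R : realType) (L dmodel dh HQ HKV : nat)
  (hL : (0 < L)%N) (hdmodel : (0 < dmodel)%N) (hdh : (0 < dh)%N)
  (hHQ : (0 < HQ)%N) (hHKV : (0 < HKV)%N)
  (pi : 'I_HQ -> 'I_HKV)
  (WQ : 'M[R]_(dmodel, HQ * dh)) (WK WV : 'M[R]_(dmodel, HKV * dh))
  (WO : 'M[R]_(HQ * dh, dmodel))
  (S : 'I_HKV -> 'M[R]_dh) (hS : forall j, orthogonal_mx (S j)) :
  let SKV := blkdiag S in
  let U := blkdiag (fun i => S (pi i)) in
  let WQ' := WQ *m U in
  let WK' := WK *m SKV in
  let WV' := WV *m SKV in
  let WO' := U^T *m WO in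
  forall X : 'M[R]_(L, dmodel),
    gqa pi WQ' WK' WV' WO' X = gqa pi WQ WK WV WO X.
Proof.
(* The cancellations need the order opposite to [hS]; it follows since [S j] is square. *)
move=> /= X; have SSt j : S j *m (S j)^T = 1%:M by apply: mulmx1C; exact: hS.
(* [U^T] moves from [WO] into the heads. *)
rewrite /gqa mulmxA tr_blkdiag hconcat_mul_blkdiag; congr (_ *m _).
rewrite /hconcat; congr castmx; apply/eq_mxrowP => i.
rewrite /gqa_head /gqa_weights !mulmxA !colblock_mul_blkdiag trmx_mul.
(* The first [SSt] cancels the factor after the values, the second the one between queries and
   keys. *)
by rewrite -!mulmxA SSt mulmx1 (mulmxA (S _)) SSt mul1mx.
Qed.
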